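(* For every integer $M\ge2$, there exist sets $\mathcal{A}\subset\mathbb{R}$ of size $M$ with complexity $C(\mathcal{A})=\lceil\log_2(M)\rceil$, which is the lowest possible complexity of a set of size $M$. Furthermore, arithmetic progressions are examples of such sets: for every $a\in\mathbb{R}$ and $x>0$, the set $\{a+ix\mid 0\le i\le M-1\}$ has complexity $\lceil\log_2(M)\rceil$.
   Context: For a finite set $\mathcal{A}\subset\mathbb{R}$, the complexity $C(\mathcal{A})$ is the smallest positive integer $\theta$ for which there exist (not necessarily distinct) real numbers $x_1,\dots,x_\theta,y_1,\dots,y_\theta$ with $\mathcal{A}\subseteq\{x_1,y_1\}+\{x_2,y_2\}+\cdots+\{x_\theta,y_\theta\}$, where $+$ denotes the sumset $\mathcal{S}+\mathcal{T}=\{s+t\mid s\in\mathcal{S},t\in\mathcal{T}\}$. *)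

(* Defs.v *)
From mathcomp Require Import all_boot all_order all_algebra finmap.
From mathcomp Require Import boolp reals exp.

Set Implicit Arguments.
Unset Strict Implicit.
Unset Printing Implicit Defensive.

Import Order.TTheory GRing.Theory Num.Theory.

Local Open Scope fset_scope.
Local Open Scope ring_scope.

Definition sumset (R : realType) (S T : {fset R}) : {fset R} :=
  [fset s + t | s in S, t in T].

(* [fset 0] is the neutral element of sumset, hence the value of the empty
   iterated sumset. As x i = y i is allowed, [fset x i; y i] may be a
   singleton. *)
Definition covered_by_pairs (R : realType) (A : {fset R}) (theta : nat) : Prop :=
  exists x y : 'I_theta -> R,
    A `<=` \big[@sumset R/[fset 0]]_(i < theta) [fset x i; y i].

Lemma sum_mem_sumset (R : realType) (n : nat) (s : 'I_n -> R)
    (S : 'I_n -> {fset R}) :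
  (forall i, s i \in S i) ->
  \sum_(i < n) s i \in \big[@sumset R/[fset 0]]_(i < n) S i.
Proof.
move=> sS; apply: (big_ind2 (fun (a : R) (A : {fset R}) => a \in A)) => //.
  by rewrite inE.
by move=> a A b B aA bB; apply/imfset2P; exists a => //; exists b.
Qed.

Lemma ex_covered_by_pairs (R : realType) (A : {fset R}) :
  exists theta : nat, (0 < theta)%N && `[< covered_by_pairs A theta >].
Proof.
pose s : seq R := 0 :: enum_fset A.
exists (size s); apply/andP; split=> //.
apply/asboolP; exists (fun i => s`_i), (fun=> 0).
apply/fsubsetP => a aA.
have ia : (index a s < size s)%N by rewrite index_mem inE aA orbT.
pose j := Ordinal ia.
have -> : a = \sum_(i < size s) (if i == j then s`_i else 0).
  rewrite -big_mkcond big_pred1_eq /= nth_index //.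
  by rewrite inE aA orbT.
by apply: sum_mem_sumset => i; rewrite !inE; case: ifP; rewrite eqxx ?orbT.
Qed.

Definition complexity (R : realType) (A : {fset R}) : nat :=
  ex_minn (ex_covered_by_pairs A).

Definition ceil_log2 (R : realType) (M : nat) : int :=
  Num.ceil (ln (M%:R : R) / ln 2%:R).

Definition arith_prog (R : realType) (a x : R) (M : nat) : {fset R} :=
  [fset a + i%:R * x | i in iota 0 M].

(* Main.v *)
(* A sumset of theta pairs has at most 2 ^ theta elements, which gives the lower
   bound.  For the progression with first term a and step x, the pairs
   {2 ^ i x, 0} cover all i x with i < 2 ^ theta by binary expansion; the
   translation by a is absorbed into the first pair. *)
Require Import Defs.
From mathcomp Require Import all_boot all_order all_algebra finmap.
From mathcomp Require Import boolp reals exp.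

Import Order.TTheory GRing.Theory Num.Theory.

Local Open Scope fset_scope.
Local Open Scope ring_scope.

Lemma card_sumset (R : realType) (S T : {fset R}) :
  (#|` sumset S T| <= #|` S| * #|` T|)%N.
Proof.
rewrite -(size_allpairs +%R (enum_fset S) (enum_fset T)).
apply: uniq_leq_size => // _ /imfset2P[s sS [t tT ->]].
by apply/allpairsP; exists (s, t).
Qed.

Lemma covered_by_pairs_card (R : realType) (A : {fset R}) (theta : nat) :
  covered_by_pairs A theta -> (#|` A| <= 2 ^ theta)%N.
Proof.
case=> x [y /fsubset_leq_card/leq_trans]; apply.
(* Writing [2 ^ theta] as a product over the same index lets [big_rec2] compare the two iterated
   operations factor by factor. *)
rewrite -[theta in (2 ^ theta)%N]card_ord -prod_nat_const.
elim/big_rec2: _ => [|i B m _ IH]; first by rewrite cardfs1.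
apply: leq_trans (card_sumset _ _ _) _; apply: leq_mul IH.
by rewrite cardfs2; case: (_ == _).
Qed.

(** [odd (j %/ 2 ^ i)] is the binary digit of [j] at position [i]. Splitting off the lowest digit
    leaves twice the same sum for [j %/ 2], so the induction on [k] keeps [j] general. *)
Lemma sum_binary_digits (k j : nat) :
  (\sum_(i < k) odd (j %/ 2 ^ i) * 2 ^ i)%N = (j %% 2 ^ k)%N.
Proof.
elim: k j => [|k IH] j; first by rewrite big_ord0 modn1.
rewrite big_ord_recl expn0 divn1 muln1.
under eq_bigr => i _ do rewrite lift0 expnS divnMA mulnCA.
rewrite -big_distrr /= IH -modn2 addnC mulnC modn_divl -expnSr.
by rewrite [RHS](divn_eq _ 2) modn_dvdm // expnS dvdn_mulr.
Qed.

Lemma arith_prog_covered (R : realType) (a x : R) (M k : nat) :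
  (0 < k)%N -> (M <= 2 ^ k)%N -> covered_by_pairs (arith_prog a x M) k.
Proof.
(* Positivity of [k] provides the first pair, which has to carry [a]. *)
case: k => // k _ leM.
pose u (i : 'I_k.+1) := if i == ord0 then a else 0.
exists u, (fun i => u i + (2 ^ i)%:R * x).
apply/fsubsetP => _ /imfsetP[j /= + ->]; rewrite mem_iota /= add0n => ltjM.
have -> : a + j%:R * x =
    \sum_(i < k.+1) (u i + (odd (j %/ 2 ^ i) * 2 ^ i)%:R * x).
  rewrite big_split /= -big_mkcond big_pred1_eq -mulr_suml -natr_sum.
  by rewrite sum_binary_digits modn_small // (leq_trans ltjM).
apply: sum_mem_sumset => i; rewrite !inE.
(* Digit 1 selects the second element of the pair, digit 0 the first. *)
by case: odd; rewrite ?mul1n ?mul0n ?mul0r ?addr0 eqxx ?orbT.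
Qed.

Lemma card_arith_prog (R : realType) (a x : R) (M : nat) :
  x != 0 -> #|` arith_prog a x M| = M.
Proof.
move=> x0; rewrite card_imfset /=; first by rewrite undup_id ?iota_uniq ?size_iota.
by move=> i j /addrI/(mulIf x0)/eqP; rewrite eqr_nat => /eqP.
Qed.

(** With [k = up_log 2 M], taking logarithms in [2 ^ (k - 1) < M <= 2 ^ k] gives the two
    inequalities that characterise the ceiling. *)
Lemma ceil_log2E (R : realType) (M : nat) :
  (2 <= M)%N -> ceil_log2 R M = (up_log 2 M)%:Z.
Proof.
move=> M2; have ln2 : 0 < ln (2%:R : R) by rewrite ln_gt0 // ltr1n.
have lnX n : ln ((2 ^ n)%:R : R) = n%:R * ln 2%:R.
  by rewrite natrX lnXn ?ltr0n // mulr_natl.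
have pos n : (0 < n)%N -> (n%:R : R) \is Num.pos by rewrite posrE ltr0n.
have M0 : (0 < M)%N by exact: ltnW.
have k0 : (0 < up_log 2 M)%N by rewrite up_log_gt0.
have /andP[lo hi] := up_log_bounds (isT : 1 < 2)%N M2.
(* As [k0] holds, the integer [k - 1] is the natural predecessor of [k], to which [lnX] applies. *)
apply: ceil_def; rewrite -[up_log 2 M in X in X < _]prednK // -addn1 PoszD addrK.
rewrite -!pmulrn ltr_pdivlMr // ler_pdivrMr // -!lnX.
by rewrite ltr_ln ?ler_ln ?ltr_nat ?ler_nat ?lo ?hi ?pos ?expn_gt0.
Qed.

(** The minimum is attained, so the cardinality bound applies at [theta = complexity A]. *)
Lemma complexity_ge (R : realType) (A : {fset R}) :
  (up_log 2 #|` A| <= complexity A)%N.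
Proof.
rewrite /complexity; case: ex_minnP => theta /andP[_ /asboolP cov] _.
exact/up_log_min/covered_by_pairs_card.
Qed.

Lemma complexity_le (R : realType) (A : {fset R}) (theta : nat) :
  (0 < theta)%N -> covered_by_pairs A theta -> (complexity A <= theta)%N.
Proof.
move=> theta0 cov; rewrite /complexity; case: ex_minnP => m _; apply.
by rewrite theta0; apply/asboolP.
Qed.

Theorem proposition6 (R : realType) (M : nat) (hM : (2 <= M)%N) :
  (exists A : {fset R}, #|` A| = M /\ (complexity A)%:Z = ceil_log2 R M) /\
  (forall A : {fset R}, #|` A| = M -> ceil_log2 R M <= (complexity A)%:Z) /\
  (forall a x : R, 0 < x ->
     #|` arith_prog a x M| = M /\
     (complexity (arith_prog a x M))%:Z = ceil_log2 R M).
Proof.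
rewrite ceil_log2E //.
(* Proved first because the case [a = 0], [x = 1] also settles existence. *)
have AP (a x : R) : 0 < x -> #|` arith_prog a x M| = M /\
    (complexity (arith_prog a x M))%:Z = (up_log 2 M)%:Z.
  move=> x0; have cardM := card_arith_prog R a x M (lt0r_neq0 x0); split=> //.
  congr Posz; apply/eqP; rewrite eqn_leq; apply/andP; split.
    apply: complexity_le; first by rewrite up_log_gt0.
    apply: arith_prog_covered; first by rewrite up_log_gt0.
    exact: up_logP.
  by rewrite -{1}cardM complexity_ge.
split; last split=> //.
- by exists (arith_prog 0 1 M); apply: AP.
- by move=> A <-; rewrite lez_nat complexity_ge.
Qed.
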